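(* Let $k$ and $n$ be positive integers. In every $k$-coloring of the edges of the complete graph $K_n$, there is a monochromatic connected component with at least $\frac{1}{k^2}\binom{n}{2}$ edges.
   Context: A $k$-coloring of the edges of $K_n$ is an arbitrary map from $E(K_n)$ to a set of $k$ colors (it need not be proper). A monochromatic connected component is a connected component of the spanning subgraph of $K_n$ formed by all edges of a single color. *)

(* Defs.v *)
From mathcomp Require Import all_boot all_order all_algebra.

Set Implicit Arguments.
Unset Strict Implicit.
Unset Printing Implicit Defensive.

Definition Kedge (n : nat) : finType := {e : {set 'I_n} | #|e| == 2}.

Definition edge_coloring (n k : nat) : Type := Kedge n -> 'I_k.

Section ColorClasses.
Variables (n k : nat) (c : edge_coloring n k) (i : 'I_k).

(* This relation is loopless: no edge has the singleton [set x; x] as value.  *)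
Definition color_adj : rel 'I_n :=
  [rel x y | [exists e : Kedge n, (val e == [set x; y]) && (c e == i)]].

(* Components are represented by their vertex sets; an isolated vertex is a   *)
(* component without edges.                                                   *)
Definition mono_components : {set {set 'I_n}} :=
  equivalence_partition (connect color_adj) [set: 'I_n].

(* Only the edges of color i count: the other edges of the complete graph     *)
(* with both endpoints in S are not edges of the component.                   *)
Definition component_edges (S : {set 'I_n}) : {set Kedge n} :=
  [set e | (c e == i) && (val e \subset S)].

End ColorClasses.

(* Main.v *)
Require Import Defs.
From mathcomp Require Import all_boot all_order all_algebra.
From mathcomp Require Import zify ring.

Import GRing.Theory Num.Theory.

(** If color [i] has [m_S] edges on the component [S], then
    [m_S ^ 2 <= M * 'C(#|S|, 2)] for [M] the largest of the [m_S].  The relation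
    [m ^ 2 <= M * 'C(a, 2)] is stable under adding the pairs [(m, a)], because
    [sqrt 'C(a, 2)] is superadditive in [a]; hence the class of color [i], with
    [m] edges in total, satisfies [m ^ 2 <= M * 'C(n, 2)].  For the most frequent
    color, [m >= 'C(n, 2) / k]. *)

Lemma sqr_leq_bin2D (M m1 m2 a1 a2 : nat) :
  m1 ^ 2 <= M * 'C(a1, 2) -> m2 ^ 2 <= M * 'C(a2, 2) ->
  (m1 + m2) ^ 2 <= M * 'C(a1 + a2, 2).
Proof.
move=> le1 le2.
have bin2E a : 'C(a, 2) * 2 + a = a * a.
  by rewrite bin_ffact ffactnS ffactn1; case: a => //= a; rewrite -mulnSr.
have bin2_le a : 'C(a, 2) * 2 <= a ^ 2 by rewrite -mulnn -bin2E leq_addr.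
(* Comparing squares avoids square roots: [4 * m1 ^ 2 * m2 ^ 2] is at most [M ^ 2] times the two
   factors ['C(a, 2) * 2], each at most [a ^ 2]. *)
have cross : 2 * (m1 * m2) <= M * (a1 * a2).
  rewrite -leq_sqr !expnMn.
  apply: leq_trans (leq_mul (leqnn _) (leq_mul le1 le2)) _.
  have -> : 2 ^ 2 * (M * 'C(a1, 2) * (M * 'C(a2, 2))) =
            M ^ 2 * ('C(a1, 2) * 2 * ('C(a2, 2) * 2)) by ring.
  by rewrite leq_mul2l leq_mul ?orbT ?bin2_le.
have -> : 'C(a1 + a2, 2) = 'C(a1, 2) + 'C(a2, 2) + a1 * a2.
  by move: (bin2E a1) (bin2E a2) (bin2E (a1 + a2)); lia.
by rewrite sqrnD !mulnDr leq_add // leq_add.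
Qed.

Lemma sum_card_color_classes {n k : nat} (c : edge_coloring n k) :
  \sum_(i < k) #|[set e | c e == i]| = 'C(n, 2).
Proof.
have <- : #|{: Kedge n}| = 'C(n, 2).
  by rewrite card_sig -[in RHS](card_ord n) -card_draws cardsE.
rewrite -sum1_card (partition_big c xpredT) //=.
by apply: eq_bigr => i _; rewrite -sum1_card; apply: eq_bigl => e; rewrite inE.
Qed.

Section ColorClass.
Context {n k : nat} (c : edge_coloring n k) (i : 'I_k).

Lemma leq_card_component_edges (S : {set 'I_n}) :
  #|component_edges c i S| <= 'C(#|S|, 2).
Proof.
rewrite -cards_draws -(card_imset _ val_inj) subset_leq_card //.
apply/subsetP => _ /imsetP[e + ->]; rewrite !inE => /andP[_ ->] /=.
exact: valP e.
Qed.

Lemma connect_color_adj_equivalence :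
  {in [set: 'I_n] & &, equivalence_rel (connect (color_adj c i))}.
Proof.
have sym : symmetric (color_adj c i).
  by move=> x y /=; apply: eq_existsb => e; rewrite setUC.
move=> x y z _ _ _; split=> [|xy]; first exact: connect0.
exact: (same_connect (sym_connect_sym sym) xy z).
Qed.

Lemma mono_components_partition :
  partition (mono_components c i) [set: 'I_n].
Proof. exact/equivalence_partitionP/connect_color_adj_equivalence. Qed.

Lemma card_color_class_leq :
  #|[set e | c e == i]| <=
  \sum_(S in mono_components c i) #|component_edges c i S|.
Proof.
have [/eqP covT _ _] := and3P mono_components_partition.
pose U := \bigcup_(S in mono_components c i) component_edges c i S.
apply: (@leq_trans #|U|); rewrite {}/U; last first.
  elim/big_rec2: _ => [|S m A _ leA]; first by rewrite cards0.
  by rewrite (leq_trans (leq_card_setU _ _)) ?leq_add2l.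
apply/subset_leq_card/subsetP => e; rewrite inE => ce.
have [x [y [_ exy]]] := cards2P _ (valP e).
(* The component of the endpoint [x] also contains [y], since [e] itself joins them in color [i]. *)
apply/bigcupP; exists (pblock (mono_components c i) x).
  by rewrite pblock_mem // covT.
rewrite inE ce exy subUset !sub1set mem_pblock covT in_setT /=.
rewrite (pblock_equivalence_partition connect_color_adj_equivalence) ?inE //.
by apply: connect1; apply/existsP; exists e; rewrite exy eqxx.
Qed.

Lemma sqr_card_color_class_leq (M : nat) :
  (forall S, S \in mono_components c i -> #|component_edges c i S| <= M) ->
  #|[set e | c e == i]| ^ 2 <= M * 'C(n, 2).
Proof.
move=> leM.
(* The components partition the vertices, so [n] becomes the sum of their sizes and the induction
   can run over edge and vertex counts together. *)
rewrite -[n in 'C(n, _)]card_ord -cardsT.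
rewrite (card_partition mono_components_partition).
have := card_color_class_leq; rewrite -leq_sqr => /leq_trans; apply.
apply: (big_ind2 (fun m a => m ^ 2 <= M * 'C(a, 2))) => //.
  by move=> *; apply: sqr_leq_bin2D.
(* For a single component, one factor of the square is bounded by [M] and the other by
   ['C(#|S|, 2)]. *)
by move=> S PS; rewrite -mulnn leq_mul ?leM ?leq_card_component_edges.
Qed.

End ColorClass.

Theorem corollary4 (k n : nat) (hk : (0 < k)%N) (hn : (0 < n)%N)
    (c : edge_coloring n k) :
  exists (i : 'I_k) (S : {set 'I_n}),
    S \in mono_components c i /\
    ((1 / k%:R ^+ 2) * 'C(n, 2)%:R <= #|component_edges c i S|%:R :> rat)%R.
Proof.
have [i _ maxi] :=
  arg_maxnP (fun i : 'I_k => #|[set e | c e == i]|)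
            (isT : xpredT (Ordinal hk)).
have le_class : 'C(n, 2) <= k * #|[set e | c e == i]|.
  rewrite -(sum_card_color_classes c) -[k in k * _]card_ord -sum_nat_const.
  by apply: leq_sum => j _; apply: maxi.
have [/eqP covT _ _] := and3P (mono_components_partition c i).
(* The component of vertex 0 starts the search for a component with the most edges. *)
have P0 : pblock (mono_components c i) (Ordinal hn)
            \in mono_components c i.
  by rewrite pblock_mem // covT.
have [S PS maxS] := arg_maxnP (fun S => #|component_edges c i S|) P0.
exists i, S; split=> //.
have le_sqr := sqr_card_color_class_leq c i _ maxS.
have le_bin : 'C(n, 2) <= #|component_edges c i S| * k ^ 2.
  (* With [m] the size of the class and [M] that of the largest component, ['C(n, 2) ^ 2 <= k ^ 2 *
     m ^ 2 <= k ^ 2 * M * 'C(n, 2)]. Cancelling ['C(n, 2)] requires it to be positive; it vanishes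
     for [n = 1]. *)
  have [-> // | bin_gt0] := posnP 'C(n, 2).
  rewrite -(leq_pmul2l bin_gt0) mulnn mulnCA mulnA [X in _ <= X]mulnC.
  apply: (@leq_trans ((k * #|[set e | c e == i]|) ^ 2)).
    by rewrite leq_sqr.
  by rewrite expnMn leq_mul2l le_sqr orbT.
rewrite mul1r mulrC ler_pdivrMr ?exprn_gt0 ?ltr0n // -natrX -natrM ler_nat.
exact: le_bin.
Qed.
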